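(* Let $\Gamma$ be an inhomogeneous $Y$-semigroup such that $Y_1 \subseteq \mathcal{D}(A_\Gamma)$ and $\Gamma$ is $Y$-strongly $t$-continuous. Assume also that $A_\Gamma(t) \in \mathcal{B}(Y_1,Y)$ for all $t \in J$ and that for all $(s,t) \in \Delta_J$ the map $u \mapsto \|A_\Gamma(u)\|_{\mathcal{B}(Y_1,Y)}$ belongs to $L^1([s,t])$. Then for all $f \in Y_1$ and $(s,t) \in \Delta_J$, \[ \Gamma(s,t)f-f=\int_s^t \Gamma(s,u) A_\Gamma(u) f\,du \] (Bochner integral in $Y$).
   Context: Let $(Y,\|\cdot\|)$ be a real separable Banach space and $(Y_1,\|\cdot\|_{Y_1})$ a real separable Banach space continuously embedded in $Y$. $\mathcal B(Y)$, $\mathcal B(Y_1,Y)$ denote bounded linear operators. $J$ is either $\mathbb{R}^+$ or $[0,T_\infty]$ ($T_\infty>0$), $\Delta_J=\{(s,t)\in J^2:s\le t\}$, $J(s)=\{t\in J:t\ge s\}$. An inhomogeneous $Y$-semigroup is a map $\Gamma:\Delta_J\to\mathcal B(Y)$ with $\Gamma(t,t)=I$ and $\Gamma(s,r)\Gamma(r,t)=\Gamma(s,t)$ for $s\le r\le t$ in $J$. Generator: for $t\in J$, $\mathcal D(A_\Gamma(t))$ is the set of $f\in Y$ such that $\lim_{h\downarrow0,\,t+h\in J}h^{-1}(\Gamma(t,t+h)-I)f$ and $\lim_{h\downarrow0,\,t-h\in J}h^{-1}(\Gamma(t-h,t)-I)f$ exist in $Y$ and are equal, $A_\Gamma(t)f$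 denoting the common value; $\mathcal D(A_\Gamma)=\bigcap_{t\in J}\mathcal D(A_\Gamma(t))$. $\Gamma$ is $Y$-strongly $t$-continuous if for every $f\in Y$, $s\in J$, $u\mapsto\Gamma(s,u)f$ is continuous from $J(s)$ into $(Y,\|\cdot\|)$. *)

(* Defs.v *)
From HB Require Import structures.
From mathcomp Require Import all_boot all_order all_algebra.
From mathcomp Require Import all_classical all_reals all_analysis measurable_realfun.
Set Implicit Arguments. Unset Strict Implicit. Unset Printing Implicit Defensive.
Import Order.TTheory GRing.Theory Num.Theory.
Import numFieldNormedType.Exports.
Local Open Scope classical_set_scope.
Local Open Scope ring_scope.

Definition separable (T : topologicalType) : Prop :=
  exists D : set T, countable D /\ closure D = setT.

Definition DeltaJ {R : realType} (J : set R) (s t : R) : Prop :=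
  J s /\ J t /\ s <= t.

Definition Jfrom {R : realType} (J : set R) (s : R) : set R :=
  [set u | J u /\ s <= u].

(* Gamma : Delta_J -> B(Y) is an inhomogeneous Y-semigroup
   (Gamma is given as a total function; only its values on Delta_J matter). *)
Definition inhom_semigroup {R : realType} (Y : normedModType R)
  (J : set R) (Gamma : R -> R -> Y -> Y) : Prop :=
  (forall s t, DeltaJ J s t ->
     linear (Gamma s t) /\ continuous (Gamma s t)) /\
  (forall t, J t -> Gamma t t = id) /\
  (forall s r t, J s -> J r -> J t -> s <= r -> r <= t ->
     Gamma s r \o Gamma r t = Gamma s t).

(* f \in D(A_Gamma(t)) with A_Gamma(t) f = g: the right limit
   lim_{h↓0, t+h∈J} h^-1 (Gamma(t,t+h) - I) f and the left limit
   lim_{h↓0, t-h∈J} h^-1 (Gamma(t-h,t) - I) f both equal g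
   (a one-sided condition is vacuous when no such h exists). *)
Definition generator_at {R : realType} (Y : normedModType R)
  (J : set R) (Gamma : R -> R -> Y -> Y) (t : R) (f g : Y) : Prop :=
  (forall e : R, 0 < e -> exists2 d : R, 0 < d &
     forall h : R, 0 < h -> h < d -> J (t + h) ->
       `| h^-1 *: (Gamma t (t + h) f - f) - g | < e) /\
  (forall e : R, 0 < e -> exists2 d : R, 0 < d &
     forall h : R, 0 < h -> h < d -> J (t - h) ->
       `| h^-1 *: (Gamma (t - h) t f - f) - g | < e).

Definition strongly_t_continuous {R : realType} (Y : normedModType R)
  (J : set R) (Gamma : R -> R -> Y -> Y) : Prop :=
  forall (f : Y) (s : R), J s ->
    {within Jfrom J s, continuous (fun u => Gamma s u f)}.

Definition opnorm {R : realType} (Y1 Y : normedModType R) (L : Y1 -> Y)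
  : \bar R :=
  ereal_sup [set (`| L x |)%:E | x in [set x : Y1 | `| x | <= 1]].

(* A simple function is a finite list of pairs (A_k, y_k), with A_k a
   measurable subset of D of finite measure: x |-> sum_k 1_{A_k}(x) y_k. *)
Definition simple_eval {R : realType} (Y : normedModType R)
  (sf : seq (set R * Y)) (x : R) : Y :=
  \sum_(p <- sf) (\1_(p.1) x : R) *: p.2.

Definition simple_int {R : realType} (Y : normedModType R)
  (sf : seq (set R * Y)) : Y :=
  \sum_(p <- sf) fine ((@lebesgue_measure R) p.1) *: p.2.

Definition simple_on {R : realType} (Y : normedModType R)
  (D : set R) (sf : seq (set R * Y)) : Prop :=
  forall p, p \in sf ->
    [/\ measurable p.1, p.1 `<=` D & ((@lebesgue_measure R) p.1 < +oo)%E].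

Definition Bochner_integral {R : realType} (Y : normedModType R)
  (D : set R) (f : R -> Y) (v : Y) : Prop :=
  exists fn : nat -> seq (set R * Y),
    [/\ forall n, simple_on D (fn n),
        {ae (@lebesgue_measure R), forall x, D x ->
           (fun n => simple_eval (fn n) x) @ \oo --> f x},
        (fun n => (\int[(@lebesgue_measure R)]_(x in D)
                     (`| simple_eval (fn n) x - f x |)%:E)%E) @ \oo --> 0%E
      & (fun n => simple_int (fn n)) @ \oo --> v].

(* Main.v *)
(** The path [F u = Gamma s u (i f)] is differentiable at every point of [[s, t]]
with derivative [Gamma s u (A u f)]: on the right this is the semigroup property,
on the left one also needs the uniform bound on [Gamma s u] given by the
Banach-Steinhaus theorem. So the claim is the fundamental theorem of calculus for
a path [F] that is differentiable everywhere and satisfies [|F'| <= g] with [g]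
integrable.

Take a lower semicontinuous integrable [G > |F'|]. Semicontinuity and
differentiability bound the increments of [F] by the integral of [G] locally, and
a supremum argument makes the bound global. The step functions whose values are
the slopes of [F] on the cells of the uniform partitions have integral exactly
[F t - F s], converge to [F'] pointwise and are dominated by the cell averages of
[G]. These averages have the same integral as [G] and an inferior limit at least
[G], so Fatou's lemma gives convergence in [L^1]. *)

Require Import Defs.
From HB Require Import structures.
From mathcomp Require Import all_boot all_order all_algebra.
From mathcomp Require Import all_classical all_reals all_analysis measurable_realfun.
From mathcomp Require Import ring lra.
Import Order.TTheory GRing.Theory Num.Theory.
Import numFieldNormedType.Exports.
Local Open Scope classical_set_scope.
Local Open Scope ring_scope.
Set Implicit Arguments. Unset Strict Implicit. Unset Printing Implicit Defensive.

(** * Lower semicontinuous majorants of integrable functions *)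

Lemma sum_indic_lsc {T : topologicalType} (R : realType) (U : nat -> set T) :
  (forall k, open (U k)) -> forall x n,
  \forall y \near x, (\sum_(0 <= k < n) (\1_(U k) x)%:E <=
                      \sum_(0 <= k < n) (\1_(U k) y)%:E :> \bar R)%E.
Proof.
move=> oU x; elim=> [|n IHn]; first by near=> y; rewrite !big_nil.
have [Ux|Ux] := pselect (U n x).
  have nU : \forall y \near x, U n y by exact: open_nbhs_nbhs.
  near=> y; rewrite !big_nat_recr//=; apply: leeD; first by near: y.
  by rewrite !indicE !mem_set//; near: y.
near=> y; rewrite !big_nat_recr//=; apply: leeD; first by near: y.
by rewrite lee_fin !indicE memNset// ler0n.
Unshelve. all: by end_near. Qed.

(** Some partial sum already exceeds the given level. Near [x] it does not drop below its value at
    [x], because the indicator of an open set equals 1 around each point of the set; the remaining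
    terms are nonnegative. *)
Lemma nneseries_indic_lsc {T : topologicalType} (R : realType) (U : nat -> set T) :
  (forall k, open (U k)) ->
  lower_semicontinuous
    (fun x => 1 + \sum_(0 <= k <oo) (\1_(U k) x)%:E : \bar R)%E.
Proof.
move=> oU x a ltax.
have ind0 y (n : nat) : (0 <= (\1_(U n) y)%:E :> \bar R)%E.
  by rewrite lee_fin indicE ler0n.
have [n an] : exists n, (a%:E < 1 + \sum_(0 <= k < n) (\1_(U k) x)%:E)%E.
  apply: contrapT => /forallNP h; move: ltax; apply/negP; rewrite -leNgt.
  rewrite addeC -leeBrDr//; apply: lime_le.
    by apply: is_cvg_nneseries => n _ _; exact: ind0.
  by apply: nearW => n; rewrite leeBrDr// addeC leNgt; apply/negP/h.
eexists; first exact: (@sum_indic_lsc _ R _ oU x n).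
move=> y /= xy; apply: (lt_le_trans an); apply: leeD => //.
by apply: (le_trans xy); apply: nneseries_lim_ge => k _ _; exact: ind0.
Qed.

(** The sum counts integer levels reached by [g x]. If the highest level is reached, [g x] is at
    least the number of terms; otherwise the last term vanishes and induction applies. *)
Lemma sum_indic_levels_le {T : Type} (R : realType) (D : set T) (g : T -> \bar R) x n :
  (0 <= g x)%E ->
  (\sum_(0 <= k < n) (\1_(D `&` [set x | (k.+1%:R%:E <= g x)%E]) x)%:E <= g x)%E.
Proof.
move=> g0; elim: n => [|n IHn]; first by rewrite big_nil.
have [ng|ng] := pselect (D x /\ (n.+1%:R%:E <= g x)%E); last first.
  by rewrite big_nat_recr//= [\1__ _]indicE memNset// adde0.
apply: le_trans ng.2; rewrite sumEFin lee_fin.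
apply: (@le_trans _ _ (\sum_(0 <= k < n.+1) 1)); last by rewrite sumr_const_nat subn0.
by apply: ler_sum => k _; rewrite indicE lern1 leq_b1.
Qed.

(* A weak form of the Vitali-Caratheodory theorem: the integral of the majorant
   is only required to be finite. *)
Lemma lsc_majorant (R : realType) (D : set R) (g : R -> \bar R) :
  measurable D -> (lebesgue_measure D < +oo)%E -> measurable_fun D g ->
  (forall x, D x -> 0 <= g x)%E ->
  (\int[lebesgue_measure]_(x in D) g x < +oo)%E ->
  exists G : R -> \bar R, [/\ lower_semicontinuous G, forall x, (0 <= G x)%E,
    forall x, D x -> forall r : R, (r%:E <= g x)%E -> (r%:E < G x)%E &
    (\int[lebesgue_measure]_(x in D) G x < +oo)%E].
Proof.
move=> mD finD mg g0 fing.
pose mu := @lebesgue_measure R.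
pose E k := D `&` [set x | (k.+1%:R%:E <= g x)%E].
have mE k : measurable (E k) by exact: emeasurable_fun_c_infty.
have finE k : (mu (E k) < +oo)%E.
  by apply: le_lt_trans finD; apply: le_measure;
    [rewrite inE; exact: mE|rewrite inE; exact: mD|exact: subIsetl].
(* The excess measures allowed here sum to at most 1, which is what [epsilon_trick] uses below. *)
have /choice[U PU] : forall k, exists U : set R,
    [/\ open U, E k `<=` U & (mu (U `\` E k) < (1 / (2 ^ k.+1)%:R)%:E)%E].
  by move=> k; apply: lebesgue_regularity_outer => //; rewrite divr_gt0// ltr0n expn_gt0.
have oU k : open (U k) by have [] := PU k.
have mU k : measurable (U k) by exact: open_measurable.
have ind0 (V : nat -> set R) y (n : nat) : (0 <= (\1_(V n) y)%:E :> \bar R)%E.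
  by rewrite lee_fin indicE ler0n.
have mind (V : nat -> set R) n : measurable (V n) ->
    measurable_fun D (fun x => (\1_(V n) x)%:E : \bar R).
  by move=> mV; apply/measurable_EFinP; exact: measurable_indic.
have intind (V : set R) : measurable V ->
    (\int[lebesgue_measure]_(x in D) (\1_V x)%:E = mu (V `&` D))%E.
  by move=> mV; exact: integral_indic.
(* For [0 <= r <= g x] the series is at least the integer part of [r]; the added 1 lifts the sum
   strictly above [r]. Its integral over [D] is finite since [D] has finite measure. *)
exists (fun x => 1 + \sum_(0 <= k <oo) (\1_(U k) x)%:E)%E; split.
- exact: nneseries_indic_lsc.
- by move=> x; apply: adde_ge0 => //; apply: nneseries_ge0 => k _ _; exact: ind0.
- move=> x Dx r rg; have [r0|r0] := ltP r 0.
    apply: (@lt_le_trans _ _ 0%E); first by rewrite lte_fin.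
    by apply: adde_ge0 => //; apply: nneseries_ge0 => k _ _; exact: ind0.
  have /andP[tr1 tr2] := Num.Theory.truncn_itv r0.
  set n := Num.truncn r in tr1 tr2.
  apply: (@lt_le_trans _ _ n.+1%:R%:E); first by rewrite lte_fin.
  rewrite -natr1 addrC EFinD leeD2l//.
  apply: (@le_trans _ _ (\sum_(0 <= k < n) (\1_(U k) x)%:E)%E); last first.
    by apply: nneseries_lim_ge => k _ _; exact: ind0.
  rewrite sumEFin lee_fin.
  apply: (@le_trans _ _ (\sum_(0 <= k < n) 1)); first by rewrite sumr_const_nat subn0.
  rewrite big_nat [leRHS]big_nat; apply: ler_sum => k /= kn.
  rewrite indicE mem_set//; have [_ + _] := PU k; apply; split => //=.
  apply: le_trans rg; rewrite lee_fin; apply: le_trans tr1.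
  by rewrite ler_nat.
- rewrite ge0_integralD//=; last 2 first.
  + by move=> x _; apply: nneseries_ge0 => k _ _; exact: ind0.
  + by apply: ge0_emeasurable_sum => // k _; exact: mind.
  apply: lte_add_pinfty; first by rewrite (integral_cst lebesgue_measure mD 1%E : _ = _) mul1e.
  rewrite integral_nneseries//; last by move=> n; exact: mind.
  apply: (@le_lt_trans _ _ (\sum_(0 <= k <oo) (mu (E k) + (1 / (2 ^ k.+1)%:R)%:E))%E).
    apply: lee_nneseries => [k _ _|k _]; first by apply: integral_ge0 => x _; exact: ind0.
    rewrite intind; last exact: mU.
    have [_ EU muU] := PU k.
    apply: (@le_trans _ _ (mu (U k))).
      by apply: le_measure;
        [rewrite inE; apply: measurableI; [exact: mU|exact: mD]
        |rewrite inE; exact: mU|exact: subIsetl].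
    rewrite -[in leLHS](setDUK EU).
    apply: (le_trans (measureU2 lebesgue_measure (mE k) (measurableD (mU k) (mE k)))).
    by apply: leeD => //; exact: ltW.
  apply: (le_lt_trans (@epsilon_trick R (fun k => mu (E k)) 1 xpredT _ _)) => //.
  (* What remains is the sum of the [mu (E k)], the integral of the number of levels reached by [g],
     hence at most the integral of [g]. *)
  rewrite lte_add_pinfty ?ltry//; apply: le_lt_trans fing.
  have muE k : mu (E k) = (\int[lebesgue_measure]_(x in D) (\1_(E k) x)%:E)%E.
    by rewrite intind// setIidl//; exact: subIsetl.
  under eq_eseriesr do rewrite muE.
  rewrite -integral_nneseries//; last by move=> n; exact: mind.
  apply: ge0_le_integral => //.
  + by move=> x _; apply: nneseries_ge0 => k _ _; exact: ind0.
  + by apply: ge0_emeasurable_sum => // k _; exact: mind.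
  + move=> x Dx; apply: lime_le; first by apply: is_cvg_nneseries => k _ _; exact: ind0.
    by apply: nearW => n; apply: sum_indic_levels_le; exact: g0.
Qed.

(** * Increments of a differentiable path *)

Lemma ereal_between_EFin (R : realType) (a : R) (y : \bar R) :
  (a%:E < y)%E -> exists2 c : R, a < c & (c%:E < y)%E.
Proof.
case: y => [r|_|//]; last by exists (a + 1); rewrite ?ltrDl ?ltr01 ?ltry.
by rewrite lte_fin => ar; exists ((a + r) / 2); rewrite ?lte_fin; lra.
Qed.

Lemma ge0_integral_itv_split (R : realType) (G : R -> \bar R) (a b c : R) :
  measurable_fun setT G -> (forall x, 0 <= G x)%E -> a <= b -> b <= c ->
  (\int[lebesgue_measure]_(x in `[a, c[) G x =
   \int[lebesgue_measure]_(x in `[a, b[) G x +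
   \int[lebesgue_measure]_(x in `[b, c[) G x)%E.
Proof.
move=> mG G0 ab bc.
rewrite (@itv_bndbnd_setU _ _ (BLeft a) (BLeft b) (BLeft c)) ?bnd_simp//.
apply: ge0_integral_setU => //; first exact: measurable_funTS.
apply/disj_setPS => x [] /=; rewrite !in_itv/= => /andP[_ xb] /andP[bx _].
by move: xb; rewrite ltNge bx.
Qed.

Lemma lebesgue_measure_itv_bo (R : realType) (a b : R) : a <= b ->
  lebesgue_measure `[a, b[%classic = (b - a)%:E.
Proof.
rewrite lebesgue_measure_itv/= lte_fin; case: ltgtP => // -> _.
by rewrite subrr.
Qed.

Lemma ge_cst_integral_itv (R : realType) (G : R -> \bar R) (a b c : R) :
  measurable_fun setT G -> a <= b -> 0 <= c ->
  (forall x, a <= x < b -> (c%:E <= G x)%E) ->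
  ((c * (b - a))%:E <= \int[lebesgue_measure]_(x in `[a, b[) G x)%E.
Proof.
move=> mG ab c0 cG.
have -> : (c * (b - a))%:E = (\int[lebesgue_measure]_(x in `[a, b[) (cst c%:E) x)%E.
  rewrite integral_cst; last exact: measurable_itv.
  by rewrite /= lebesgue_measure_itv_bo.
apply: ge0_le_integral => //.
exact: measurable_funTS.
Qed.

(** The error is compared with [|y - x|] without dividing, so [y = x] is harmless and the derivative
    is automatically one-sided at [s] and [t]. *)
Definition derivative_within {R : realType} {Y : normedModType R} (s t : R)
    (F dF : R -> Y) : Prop :=
  forall x, s <= x <= t -> forall e, 0 < e -> exists2 d, 0 < d &
    forall y, s <= y <= t -> `|y - x| < d ->
      `|F y - F x - (y - x) *: dF x| <= e * `|y - x|.

Section increments.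
Context {R : realType} {Y : normedModType R}.
Variables (s t : R) (F dF : R -> Y).
Hypothesis derF : derivative_within s t F dF.

(** Subtract the expansions of [F b] and [F a] at [x]. As [x] lies between [a] and [b], the errors
    [e * (b - x)] and [e * (x - a)] add up to exactly [e * (b - a)]. *)
Lemma straddle x e : s <= x <= t -> 0 < e -> exists2 d, 0 < d &
  forall a b, s <= a -> a <= x -> x <= b -> b <= t -> b - a < d ->
    `|F b - F a - (b - a) *: dF x| <= e * (b - a).
Proof.
move=> xst e0; have [d d0 Hd] := derF xst e0; exists d => // a b sa ax xb bt bad.
have /andP[sx xt] := xst.
have Hb : `|F b - F x - (b - x) *: dF x| <= e * (b - x).
  have bx : `|b - x| = b - x by rewrite ger0_norm ?subr_ge0.
  rewrite -[in leRHS]bx; apply: Hd; first by rewrite bt andbT (le_trans sx).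
  by rewrite bx; lra.
have Ha : `|F a - F x - (a - x) *: dF x| <= e * (x - a).
  have ax' : `|a - x| = x - a by rewrite distrC ger0_norm ?subr_ge0.
  rewrite -[in leRHS]ax'; apply: Hd; first by rewrite sa (le_trans ax).
  by rewrite ax'; lra.
have -> : F b - F a - (b - a) *: dF x =
    (F b - F x - (b - x) *: dF x) - (F a - F x - (a - x) *: dF x).
  rewrite (_ : b - a = (b - x) - (a - x)); last by ring.
  have H (u p v q : Y) : (u - p) - (v - q) = u - v - (p - q).
    by rewrite !opprD !opprK addrACA.
  rewrite H scalerBl (_ : F b - F x - (F a - F x) = F b - F a)//.
  by rewrite opprB addrA subrK.
apply: (le_trans (ler_normB _ _)); apply: (le_trans (lerD Hb Ha)).
by rewrite -mulrDr addrA subrK.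
Qed.

Variable G : R -> \bar R.
Hypothesis lscG : lower_semicontinuous G.
Hypothesis G0 : forall x, (0 <= G x)%E.
Hypothesis dFG : forall x, s <= x <= t -> (`|dF x|%:E < G x)%E.

Let mG : measurable_fun setT G := lower_semicontinuous_measurable lscG.

(** For [c] strictly between [|dF x|] and [G x], the slack [c - |dF x|] absorbs the expansion error,
    so increments around [x] are at most [c * (b - a)]; semicontinuity keeps [G] above [c] there. *)
Lemma local_increment_le_integral x : s <= x <= t -> exists2 d, 0 < d &
  forall a b, s <= a -> a <= x -> x <= b -> b <= t -> b - a < d ->
    (`|F b - F a|%:E <= \int[lebesgue_measure]_(u in `[a, b[) G u)%E.
Proof.
move=> xst.
have [c dFc cG] := ereal_between_EFin (dFG xst).
have [V /nbhs_ballP[r /= r0 rV] VG] := lscG cG.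
have e0 : 0 < c - `|dF x| by rewrite subr_gt0.
have [d d0 Hd] := straddle xst e0.
exists (Num.min d r); first by rewrite lt_min d0.
move=> a b sa ax xb bt; rewrite lt_min => /andP[bad bar].
have ab := le_trans ax xb.
apply: (@le_trans _ _ (c * (b - a))%:E); last first.
  apply: ge_cst_integral_itv => //; first by rewrite (le_trans _ (ltW dFc)).
  move=> y /andP[ay yb]; apply/ltW/VG/rV; rewrite /ball/= /ball_.
  by rewrite ltr_norml; apply/andP; split; lra.
rewrite lee_fin -[F b - F a](subrK ((b - a) *: dF x)).
apply: (le_trans (ler_normD _ _)).
apply: (@le_trans _ _ ((c - `|dF x|) * (b - a) + (b - a) * `|dF x|)).
  rewrite lerD ?Hd// normrZ ger0_norm// subr_ge0//.
by rewrite le_eqVlt; apply/orP; left; apply/eqP; ring.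
Qed.

(** Let [c] be the supremum of the endpoints reached from [a]. The local bound at [c], applied from
    some [y] in [S] just below [c], carries the inequality to [c] and beyond it, unless [c = b]. *)
Lemma increment_le_integral a b : s <= a -> a <= b -> b <= t ->
  (`|F b - F a|%:E <= \int[lebesgue_measure]_(u in `[a, b[) G u)%E.
Proof.
move=> sa ab bt.
pose S := [set y | a <= y <= b /\
  (`|F y - F a|%:E <= \int[lebesgue_measure]_(u in `[a, y[) G u)%E].
have Sa : S a.
  by split; rewrite ?lexx//= subrr normr0; apply: integral_ge0.
have ubS : ubound S b by move=> y [/andP[]].
have supS : has_sup S by split; [exists a|exists b].
set c := sup S.
have ac : a <= c by apply: ub_le_sup => //; exists b.
have cb : c <= b by apply: ge_sup => //; exists a.
have cst : s <= c <= t by rewrite (le_trans sa ac) (le_trans cb bt).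
have [d d0 Hd] := local_increment_le_integral cst.
have [y Sy ycd] := sup_adherent d0 supS.
have [/andP[ay yb] Hy] := Sy.
have yc : y <= c by apply: ub_le_sup => //; exists b.
have step z : c <= z -> z <= b -> z - y < d -> S z.
  move=> cz zb zy; split; first by rewrite zb (le_trans ac cz).
  rewrite (ge0_integral_itv_split (b := y))//; last exact: le_trans cz.
  apply: (@le_trans _ _ (`|F y - F a|%:E + `|F z - F y|%:E)%E).
    by rewrite lee_fin addrC (le_trans _ (ler_normD _ _))// addrA subrK.
  apply: leeD => //; apply: Hd => //; first exact: le_trans ay.
  exact: le_trans bt.
suff cEb : c = b.
  by have [] : S b by apply: step; rewrite -?cEb//; move: ycd; rewrite -/c; lra.
apply/eqP; rewrite eq_le cb leNgt/=; apply/negP => ltcb.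
(* Since [c < y + d], the midpoint lies beyond [c] yet within distance [d] of [y]. *)
pose z := Num.min b ((c + (y + d)) / 2).
have ltcz : c < z by rewrite lt_min ltcb /=; move: ycd; rewrite -/c; lra.
have Sz : S z.
  apply: step; [exact: ltW|by rewrite ge_min lexx|].
  have : z <= (c + (y + d)) / 2 by rewrite ge_min lexx orbT.
  by move: ycd; rewrite -/c; lra.
have : z <= c by apply: ub_le_sup => //; exists b.
by rewrite leNgt ltcz.
Qed.

End increments.

(** * Inferior limits of extended real sequences *)

Section limn_einf_bounds.
Context {R : realType}.
Implicit Type u : (\bar R)^nat.
Local Open Scope ereal_scope.

Let limn_einf_sup_einfs u : limn_einf u = ereal_sup (range (einfs u)).
Proof. by rewrite limn_einf_lim; apply/cvg_lim => //; exact: cvg_einfs_sup. Qed.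

Lemma le_limn_einf u l :
  (forall c : R, c%:E < l -> \forall n \near \oo, c%:E <= u n) -> l <= limn_einf u.
Proof.
move=> H; have {}H (c : R) : c%:E < l -> c%:E <= limn_einf u.
  move=> /H[N _ HN]; rewrite limn_einf_sup_einfs.
  apply: (@le_trans _ _ (einfs u N)); last by apply: ereal_sup_ubound; exists N.
  by apply: le_ereal_inf_tmp => _ [k /= Nk <-]; exact: HN.
case: l H => [r|H|_]; last exact: leNye.
  move=> H; apply/lee_subgt0Pr => e e0; rewrite -EFinB; apply: H.
  by rewrite lte_fin ltrBlDr ltrDl.
by rewrite (@eq_infty _ (limn_einf u))// => r; apply: H; exact: ltry.
Qed.

Lemma lt_limn_einf u (c : \bar R) :
  c < limn_einf u -> \forall n \near \oo, c < u n.
Proof.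
rewrite limn_einf_sup_einfs => /ereal_sup_gt[_ [N _ <-] cN].
exists N => // n /= Nn; apply: (lt_le_trans cN).
by apply: ereal_inf_lbound; exists n.
Qed.

End limn_einf_bounds.

(** A simple function has finitely many values, so [N] can be arbitrary. This generality drives the
    induction: with head [(A, y)], the tail is composed with [N (y + _)] on [A] and with [N] off
    [A]. *)
Lemma measurable_simple_eval (R : realType) (Y : normedModType R)
    (sf : seq (set R * Y)) (N : Y -> R) (D : set R) :
  (forall p, p \in sf -> measurable p.1) ->
  measurable_fun D (fun x => N (simple_eval sf x)).
Proof.
rewrite /simple_eval; elim: sf N => [|[A y] sf IH] N mA.
  by apply: (eq_measurable_fun (cst (N 0))) => // x _; rewrite big_nil.
have mAA : measurable A by apply: (mA (A, y)); rewrite mem_head.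
have mS (M : Y -> R) :
    measurable_fun D (fun x => M (\sum_(p <- sf) (\1_(p.1) x : R) *: p.2)).
  by apply: IH => p psf; apply: mA; rewrite inE psf orbT.
apply: (eq_measurable_fun (fun x =>
   \1_A x * N (y + \sum_(p <- sf) (\1_(p.1) x : R) *: p.2) +
   (1 - \1_A x) * N (\sum_(p <- sf) (\1_(p.1) x : R) *: p.2))).
  move=> x _; rewrite big_cons/= indicE; case: (x \in A).
    by rewrite scale1r mul1r subrr mul0r addr0.
  by rewrite scale0r add0r mul0r add0r subr0 mul1r.
apply: measurable_funD; apply: measurable_funM.
- exact: measurable_indic.
- exact: (mS (fun z => N (y + z))).
- by apply: measurable_funB; [exact: measurable_cst|exact: measurable_indic].
- exact: mS.
Qed.

(** * Uniform partitions of the interval *)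

Section partition.
Context {R : realType}.
Variables (s t : R).
Hypothesis st : s < t.

(** Index [n] stands for [n.+1] cells, which avoids division by zero. *)
Definition mesh (n : nat) : R := (t - s) / n.+1%:R.
Definition node (n k : nat) : R := s + k%:R * mesh n.
(** Half-open, so that the cells tile [[s, t[] without overlap. *)
Definition cell (n k : nat) : set R := `[node n k, node n k.+1[%classic.

Lemma mesh_gt0 n : 0 < mesh n.
Proof. by rewrite divr_gt0// subr_gt0. Qed.

Lemma nodeS n k : node n k.+1 = node n k + mesh n.
Proof. by rewrite /node -natr1 mulrDl mul1r addrA. Qed.

Lemma node_nondecreasing n j k : (j <= k)%N -> node n j <= node n k.
Proof. by move=> jk; rewrite lerD2l ler_pM2r ?ler_nat// mesh_gt0. Qed.

Lemma node0 n : node n 0 = s.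
Proof. by rewrite /node mul0r addr0. Qed.

Lemma node_last n : node n n.+1 = t.
Proof. by rewrite /node /mesh mulrC divfK ?pnatr_eq0// addrC subrK. Qed.

Lemma node_bounds n k : (k < n.+1)%N -> s <= node n k /\ node n k.+1 <= t.
Proof.
move=> kn; rewrite -[X in X <= _ /\ _](node0 n) -[X in _ /\ _ <= X](node_last n).
by split; exact: node_nondecreasing.
Qed.

Lemma measurable_cell n k : measurable (cell n k).
Proof. exact: measurable_itv. Qed.

Lemma cell_sub n k : (k < n.+1)%N -> cell n k `<=` `[s, t[.
Proof.
move=> kn x; rewrite /cell/= !in_itv/= => /andP[kx xk].
by have [sk kt] := node_bounds kn; rewrite (le_trans sk kx) (lt_le_trans xk kt).
Qed.

Lemma lebesgue_measure_cell n k : lebesgue_measure (cell n k) = (mesh n)%:E.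
Proof.
rewrite lebesgue_measure_itv_bo ?node_nondecreasing//.
by rewrite nodeS addrAC subrr add0r.
Qed.

Lemma cell_ex n x : s <= x < t -> exists2 j, (j < n.+1)%N & cell n j x.
Proof.
move=> /andP[sx xt]; have h0 := mesh_gt0 n.
have q0 : 0 <= (x - s) / mesh n by rewrite divr_ge0 ?subr_ge0// ltW.
have /andP[q1 q2] := Num.Theory.truncn_itv q0.
move: q1 q2; set j := Num.truncn _; rewrite ler_pdivlMr// ltr_pdivrMr// => q1 q2.
exists j; last by rewrite /cell/= in_itv/= /node; apply/andP; split; lra.
rewrite -(@ltr_nat R) -(ltr_pM2r h0); apply: (le_lt_trans q1).
by have := node_last n; rewrite /node; lra.
Qed.

(** Stated over a module to serve both the slopes in [Y] and, through [R^o], the real averages. *)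
Lemma sum_cell (V : lmodType R) (c : nat -> V) n j x :
  (j < n.+1)%N -> cell n j x ->
  \sum_(0 <= k < n.+1) (\1_(cell n k) x : R) *: c k = c j.
Proof.
move=> jn jx; rewrite (bigD1_seq j) ?mem_index_iota ?iota_uniq//=.
rewrite indicE mem_set// scale1r big1 ?addr0// => k kj.
rewrite indicE memNset ?scale0r// => kx.
move: jx kx; rewrite /cell/= !in_itv/= => /andP[j1 j2] /andP[k1 k2].
move: kj; rewrite neq_ltn => /orP[kj|jk].
  by have := node_nondecreasing n kj; rewrite leNgt (le_lt_trans j1).
by have := node_nondecreasing n jk; rewrite leNgt (le_lt_trans k1).
Qed.

Lemma near_mesh_lt d : 0 < d -> \forall n \near \oo, mesh n < d.
Proof.
move=> d0; exists (Num.truncn ((t - s) / d)) => // n /= Nn.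
rewrite ltr_pdivrMr// mulrC -ltr_pdivrMr//.
by apply: (lt_le_trans (truncnS_gt _)); rewrite ler_nat.
Qed.

Lemma sum_integral_cell (G : R -> \bar R) n :
  measurable_fun setT G -> (forall x, 0 <= G x)%E ->
  (\sum_(0 <= k < n.+1) \int[lebesgue_measure]_(x in cell n k) G x =
   \int[lebesgue_measure]_(x in `[s, t[) G x)%E.
Proof.
move=> mG G0; rewrite -[in RHS](node_last n).
elim: n.+1 => [|m IHm]; first by rewrite big_nil node0 set_itvco0 integral_set0.
rewrite big_nat_recr//= IHm [RHS](ge0_integral_itv_split mG G0 (b := node n m))//.
  by rewrite -[leLHS](node0 n) node_nondecreasing.
exact: node_nondecreasing.
Qed.

End partition.

(** * Convergence of the slopes to the derivative *)

Section derivative_integral.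
Context {R : realType} {Y : normedModType R}.
Variables (s t : R) (F dF : R -> Y) (G : R -> \bar R).
Hypotheses (st : s < t) (derF : derivative_within s t F dF).
Hypotheses (lscG : lower_semicontinuous G) (G0 : forall x, (0 <= G x)%E).
Hypothesis dFG : forall x, s <= x <= t -> (`|dF x|%:E < G x)%E.
Hypothesis intG : (\int[lebesgue_measure]_(x in `[s, t[) G x < +oo)%E.

Local Notation mesh := (mesh s t).
Local Notation node := (node s t).
Local Notation cell := (cell s t).

Let mG : measurable_fun setT G := lower_semicontinuous_measurable lscG.

Definition slope (n k : nat) : Y := (mesh n)^-1 *: (F (node n k.+1) - F (node n k)).

Definition slopes (n : nat) : seq (set R * Y) :=
  [seq (cell n k, slope n k) | k <- index_iota 0 n.+1].

Lemma slopes_evalE n x : simple_eval (slopes n) x =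
  \sum_(0 <= k < n.+1) (\1_(cell n k) x : R) *: slope n k.
Proof. by rewrite /simple_eval big_map. Qed.

Lemma slopes_int n : simple_int (slopes n) = F t - F s.
Proof.
transitivity (F (node n n.+1) - F (node n 0)); last by rewrite node_last node0.
rewrite /simple_int big_map -(telescope_sumr (fun k => F (node n k)))//.
apply: eq_bigr => k _; rewrite /= (lebesgue_measure_cell st)/= scalerA divff ?scale1r//.
by rewrite gt_eqF// mesh_gt0.
Qed.

Lemma slopes_on n : simple_on `[s, t] (slopes n).
Proof.
move=> p /mapP[k]; rewrite mem_index_iota /= => kn ->; split => /=.
- exact: measurable_cell.
- apply: (subset_trans (cell_sub st kn)) => x /=; rewrite !in_itv/= => /andP[-> /ltW].
  by [].
- by rewrite (lebesgue_measure_cell st) ltry.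
Qed.

(** The cell of [x] straddles [x] and is eventually shorter than [d], so [straddle] applies to its
    endpoints. *)
Lemma slopes_cvg x : s <= x < t -> simple_eval (slopes n) x @[n --> \oo] --> dF x.
Proof.
move=> xst; have /andP[sx xt] := xst.
have xst' : s <= x <= t by rewrite sx ltW.
apply/cvgrPdist_le => e e0.
have [d d0 Hd] := straddle derF xst' e0.
near=> n.
have [j jn jx] := cell_ex st n xst.
rewrite slopes_evalE (sum_cell st (slope n) jn jx).
have h0 := mesh_gt0 st n.
have hnd : mesh n < d by near: n; exact: near_mesh_lt.
have hE : node n j.+1 - node n j = mesh n by rewrite nodeS addrAC subrr add0r.
move: jx; rewrite /cell/= in_itv/= => /andP[jx xj].
have [sj jt] := node_bounds st jn.
have := Hd _ _ sj jx (ltW xj) jt; rewrite hE => /(_ hnd) Hj.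
rewrite distrC -(ler_pM2r h0).
suff -> : `|slope n j - dF x| * mesh n =
    `|F (node n j.+1) - F (node n j) - mesh n *: dF x| by [].
rewrite -[in LHS](gtr0_norm h0) mulrC -normrZ scalerBr /slope scalerA divff ?scale1r//.
by rewrite gt_eqF.
Unshelve. all: by end_near. Qed.

Let int_cell_fin n k : (k < n.+1)%N ->
  (\int[lebesgue_measure]_(x in cell n k) G x)%E \is a fin_num.
Proof.
move=> kn; rewrite ge0_fin_numE; last by apply: integral_ge0.
apply: le_lt_trans intG; apply: ge0_subset_integral => //.
- exact: measurable_cell.
- exact: measurable_funTS.
- exact: cell_sub.
Qed.

Definition average (n k : nat) : R :=
  (mesh n)^-1 * fine (\int[lebesgue_measure]_(x in cell n k) G x)%E.

Definition averages (n : nat) (x : R) : R :=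
  \sum_(0 <= k < n.+1) \1_(cell n k) x * average n k.

Lemma averagesE n j x : (j < n.+1)%N -> cell n j x -> averages n x = average n j.
Proof. by move=> jn jx; rewrite -(sum_cell st (average n : nat -> R^o) jn jx). Qed.

Lemma average_ge0 n k : 0 <= average n k.
Proof.
by rewrite mulr_ge0 ?fine_ge0 ?integral_ge0// invr_ge0 ltW// mesh_gt0.
Qed.

Lemma averages_ge0 n x : 0 <= averages n x.
Proof.
by apply: sumr_ge0 => k _; rewrite mulr_ge0 ?average_ge0// indicE ler0n.
Qed.

Lemma measurable_averages n D : measurable_fun D (averages n).
Proof.
apply: measurable_sum => k; apply: measurable_funM => //.
by apply: measurable_indic; exact: measurable_cell.
Qed.

Lemma norm_slope_le n k : (k < n.+1)%N -> `|slope n k| <= average n k.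
Proof.
move=> kn; have h0 := mesh_gt0 st n.
rewrite normrZ gtr0_norm ?invr_gt0// ler_pM2l ?invr_gt0//.
rewrite -lee_fin fineK ?int_cell_fin//.
have [sk kt] := node_bounds st kn.
by apply: (increment_le_integral derF lscG G0 dFG) => //; exact: node_nondecreasing.
Qed.

(** Semicontinuity gives a ball around [x] on which [G] exceeds [c]; it contains the cell of [x]
    once the mesh is below its radius. *)
Lemma near_averages_ge x (c : R) : s <= x < t -> 0 <= c -> (c%:E < G x)%E ->
  \forall n \near \oo, c <= averages n x.
Proof.
move=> xst c0 cG.
have [V /nbhs_ballP[r /= r0 rV] VG] := lscG cG.
near=> n.
have [j jn jx] := cell_ex st n xst.
rewrite (averagesE jn jx) /average mulrC ler_pdivlMr ?mesh_gt0//.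
have hnr : mesh n < r by near: n; exact: near_mesh_lt.
have hE : node n j.+1 - node n j = mesh n by rewrite nodeS addrAC subrr add0r.
rewrite -lee_fin fineK ?int_cell_fin// -hE.
apply: ge_cst_integral_itv => //; first exact: node_nondecreasing.
move=> y /andP[jy yj]; apply/ltW/VG/rV; rewrite /ball/= /ball_.
move: jx; rewrite /cell/= in_itv/= => /andP[jx xj].
by rewrite ltr_norml; apply/andP; split; lra.
Unshelve. all: by end_near. Qed.

Lemma integral_averages n :
  (\int[lebesgue_measure]_(x in `[s, t[) (averages n x)%:E =
   \int[lebesgue_measure]_(x in `[s, t[) G x)%E.
Proof.
rewrite -(sum_integral_cell st n mG G0).
under eq_integral do rewrite -sumEFin.
rewrite ge0_integral_sum//=; last 2 first.
- move=> k; apply/measurable_EFinP; apply: measurable_funM => //.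
  by apply: measurable_indic; exact: measurable_cell.
- by move=> k x _; rewrite lee_fin mulr_ge0 ?average_ge0// indicE ler0n.
rewrite big_nat [RHS]big_nat; apply: eq_bigr => k /= kn.
under eq_integral do rewrite mulrC EFinM.
rewrite ge0_integralZl_EFin//=; last 2 first.
- by apply/measurable_EFinP; apply: measurable_indic; exact: measurable_cell.
- exact: average_ge0.
rewrite integral_indic//; last exact: measurable_cell.
rewrite setIidl; last exact: cell_sub.
rewrite /= (lebesgue_measure_cell st) -EFinM /average mulrAC mulVf ?mul1r ?fineK ?int_cell_fin//.
by rewrite gt_eqF// mesh_gt0.
Qed.

Let measurable_slopes n p : p \in slopes n -> measurable p.1.
Proof. by move=> /mapP[k _ ->]; exact: measurable_cell. Qed.

Lemma measurable_norm_derivative : measurable_fun `[s, t[ (fun x => `|dF x|).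
Proof.
apply: (@measurable_fun_cvg _ _ _ _ (fun n x => `|simple_eval (slopes n) x|)).
  move=> n; apply: (measurable_simple_eval (fun y => `|y|)).
  exact: measurable_slopes.
by move=> x; rewrite /= in_itv/= => xst; apply: cvg_norm; exact: slopes_cvg.
Qed.

(** The derivative is replaced by [slopes m] and [m] tends to infinity. A difference of simple
    functions is again simple: append the second list with negated values. *)
Lemma measurable_slopes_dist n :
  measurable_fun `[s, t[ (fun x => `|simple_eval (slopes n) x - dF x|).
Proof.
pose opp_slopes m : seq (set R * Y) := [seq (p.1, - p.2) | p <- slopes m].
have dE m x : simple_eval (slopes n ++ opp_slopes m) x =
    simple_eval (slopes n) x - simple_eval (slopes m) x.
  rewrite /simple_eval big_cat/= -sumrN; congr (_ + _).
  by rewrite /opp_slopes big_map; apply: eq_bigr => p _; rewrite scalerN.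
apply: (@measurable_fun_cvg _ _ _ _
  (fun m x => `|simple_eval (slopes n) x - simple_eval (slopes m) x|)).
  move=> m; apply: (eq_measurable_fun
    (fun x => `|simple_eval (slopes n ++ opp_slopes m) x|)).
    by move=> x _; rewrite dE.
  apply: (measurable_simple_eval (fun y => `|y|)) => p.
  rewrite mem_cat => /orP[|/mapP[q + ->]]; exact: measurable_slopes.
move=> x; rewrite /= in_itv/= => xst; apply: cvg_norm; apply: cvgB.
  exact: cvg_cst.
exact: slopes_cvg.
Qed.

Lemma slopes_dist_le n x : s <= x < t ->
  `|simple_eval (slopes n) x - dF x| <= averages n x + `|dF x|.
Proof.
move=> xst; apply: (le_trans (ler_normB _ _)); rewrite lerD2r.
have [j jn jx] := cell_ex st n xst.
by rewrite (averagesE jn jx) slopes_evalE (sum_cell st (slope n) jn jx) norm_slope_le.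
Qed.

(* Fatou's lemma is applied to this gap between the two sides of
   [slopes_dist_le]. *)
Let gap n x := averages n x + `|dF x| - `|simple_eval (slopes n) x - dF x|.

Let gap_ge0 n x : s <= x < t -> 0 <= gap n x.
Proof. by move=> xst; rewrite subr_ge0 slopes_dist_le. Qed.

Let measurable_gap n : measurable_fun `[s, t[ (gap n).
Proof.
apply: measurable_funB; last exact: measurable_slopes_dist.
by apply: measurable_funD; [exact: measurable_averages|exact: measurable_norm_derivative].
Qed.

(** The averages eventually reach every level below [G x], while the subtracted distance tends to
    0. *)
Lemma gap_liminf x : s <= x < t ->
  (G x + `|dF x|%:E <= limn_einf (fun n => (gap n x)%:E))%E.
Proof.
move=> xst; apply: le_limn_einf => c; rewrite -lteBlDr// -EFinB.
have xst' : s <= x <= t by have /andP[-> /ltW ->] := xst.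
have G_gt0 : (0 < G x)%E by apply: le_lt_trans (dFG xst').
move=> /ereal_between_EFin[c1 cc1 c1G].
(* [near_averages_ge] needs a nonnegative level; 0 is still below [G x], which is positive. *)
pose c2 := Num.max c1 0.
have c2G : (c2%:E < G x)%E by rewrite EFin_max gt_max c1G.
have c20 : 0 <= c2 by rewrite le_max lexx orbT.
have c12 : c1 <= c2 by rewrite le_max lexx.
have e0 : 0 < c2 - (c - `|dF x|) by rewrite subr_gt0 (lt_le_trans cc1).
have avgc := near_averages_ge xst c20 c2G.
have /cvgrPdist_le/(_ _ e0) dist_small := slopes_cvg xst.
near=> n; rewrite lee_fin /gap.
have : c2 <= averages n x by near: n.
have : `|simple_eval (slopes n) x - dF x| <= c2 - (c - `|dF x|).
  by rewrite distrC; near: n.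
by lra.
Unshelve. all: by end_near. Qed.

(** The integrals of the gap and of the distance add up to the same finite [C] for every [n]. Fatou
    makes the inferior limit of the first at least [C], so the second is eventually below any
    [e]. *)
Lemma integral_slopes_dist_cvg0 :
  (\int[lebesgue_measure]_(x in `[s, t[)
    `|simple_eval (slopes n) x - dF x|%:E)%E @[n --> \oo] --> 0%E.
Proof.
pose C := (\int[lebesgue_measure]_(x in `[s, t[) G x +
           \int[lebesgue_measure]_(x in `[s, t[) `|dF x|%:E)%E.
have intD (f g : R -> \bar R) : measurable_fun `[s, t[ f -> measurable_fun `[s, t[ g ->
    (forall x, `[s, t[%classic x -> 0 <= f x)%E ->
    (forall x, `[s, t[%classic x -> 0 <= g x)%E ->
    (\int[lebesgue_measure]_(x in `[s, t[) (f x + g x) =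
     \int[lebesgue_measure]_(x in `[s, t[) f x + \int[lebesgue_measure]_(x in `[s, t[) g x)%E.
  by move=> mf mg f0 g0; exact: ge0_integralD.
have mGD : measurable_fun `[s, t[ G by exact: measurable_funTS.
have mdF : measurable_fun `[s, t[ (fun x => `|dF x|%:E).
  by apply/measurable_EFinP; exact: measurable_norm_derivative.
have mavg n : measurable_fun `[s, t[ (fun x => (averages n x)%:E).
  by apply/measurable_EFinP; exact: measurable_averages.
have mgap n : measurable_fun `[s, t[ (fun x => (gap n x)%:E).
  by apply/measurable_EFinP; exact: measurable_gap.
have mdist n : measurable_fun `[s, t[ (fun x => `|simple_eval (slopes n) x - dF x|%:E).
  by apply/measurable_EFinP; exact: measurable_slopes_dist.
have gap0 n x : `[s, t[%classic x -> (0 <= (gap n x)%:E)%E.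
  by rewrite /= in_itv/= lee_fin; exact: gap_ge0.
have C_lty : (C < +oo)%E.
  rewrite lte_add_pinfty//; apply: le_lt_trans intG; apply: ge0_le_integral => //.
  move=> x; rewrite /= in_itv/= => /andP[sx xt]; apply/ltW/dFG.
  by rewrite sx ltW.
have Cfin : C \is a fin_num.
  by rewrite ge0_fin_numE// adde_ge0// integral_ge0.
have sumC n : (\int[lebesgue_measure]_(x in `[s, t[) (gap n x)%:E +
    \int[lebesgue_measure]_(x in `[s, t[) `|simple_eval (slopes n) x - dF x|%:E)%E = C.
  have avg0 x : `[s, t[%classic x -> (0 <= (averages n x)%:E)%E.
    by rewrite lee_fin averages_ge0.
  rewrite /C -(integral_averages n) -(intD _ _ (mavg n) mdF avg0)//.
  rewrite -(intD _ _ (mgap n) (mdist n) (gap0 n))//.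
  by apply: eq_integral => x _; rewrite -!EFinD /gap subrK.
have C_le : (C <= limn_einf (fun n => \int[lebesgue_measure]_(x in `[s, t[) (gap n x)%:E))%E.
  have fatou_gap : (\int[lebesgue_measure]_(x in `[s, t[)
        limn_einf (fun n => (gap n x)%:E) <=
      limn_einf (fun n => \int[lebesgue_measure]_(x in `[s, t[) (gap n x)%:E))%E.
    exact: fatou.
  apply: le_trans fatou_gap.
  rewrite /C -intD//; apply: ge0_le_integral => //.
  - by move=> x _; rewrite adde_ge0.
  - exact: emeasurable_funD.
  - apply: (@emeasurable_fun_cvg _ _ _ _ (fun n x => einfs (fun m => (gap m x)%:E) n)).
      by move=> n; exact: measurable_fun_einfs.
    by move=> x _; rewrite limn_einf_lim; exact: is_cvg_einfs.
  - by move=> x; rewrite /= in_itv/= => xst; exact: gap_liminf.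
have intgap0 n : (0 <= \int[lebesgue_measure]_(x in `[s, t[) (gap n x)%:E)%E.
  by apply: integral_ge0 => x; exact: gap0.
have dist0 n : (0 <= \int[lebesgue_measure]_(x in `[s, t[)
    `|simple_eval (slopes n) x - dF x|%:E)%E by exact: integral_ge0.
have distfin n : (\int[lebesgue_measure]_(x in `[s, t[)
    `|simple_eval (slopes n) x - dF x|%:E)%E \is a fin_num.
  rewrite ge0_fin_numE// (le_lt_trans _ C_lty)//.
  by rewrite -(sumC n) leeDr.
apply/fine_cvgP; split; first exact: nearW.
apply/cvgr0Pnorm_lt => e e0.
have : (C - e%:E < limn_einf (fun n =>
    \int[lebesgue_measure]_(x in `[s, t[) (gap n x)%:E))%E.
  by apply: lt_le_trans C_le; rewrite lteBlDr// lteDl// lte_fin.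
move=> /lt_limn_einf[N _ HN]; exists N => // n /= Nn.
have Hn : (C - e%:E < \int[lebesgue_measure]_(x in `[s, t[) (gap n x)%:E)%E := HN n Nn.
rewrite /= ger0_norm ?fine_ge0// -lte_fin fineK//.
move: Hn; rewrite lteBlDr// -[X in (X < _)%E](sumC n) lteD2lE//.
rewrite ge0_fin_numE//.
rewrite (le_lt_trans _ C_lty)//.
by rewrite -(sumC n) leeDl.
Qed.

Lemma Bochner_integral_of_lsc_majorant : Bochner_integral `[s, t] dF (F t - F s).
Proof.
exists slopes; split.
- exact: slopes_on.
(* The endpoint [t] lies in no cell, so convergence may fail there. *)
- exists [set t]; split => //; first exact: lebesgue_measure_set1.
  move=> x /= /not_implyP[]; rewrite in_itv/= => /andP[sx]; rewrite le_eqVlt.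
  by move=> /predU1P[//|xt] /=; case; apply: slopes_cvg; rewrite sx.
- have intE n : (\int[lebesgue_measure]_(x in `[s, t])
      `|simple_eval (slopes n) x - dF x|%:E =
    \int[lebesgue_measure]_(x in `[s, t[)
      `|simple_eval (slopes n) x - dF x|%:E)%E.
    rewrite integral_itv_bndo_bndc//; apply/measurable_EFinP.
    exact: measurable_slopes_dist.
  under eq_fun do rewrite intE.
  exact: integral_slopes_dist_cvg0.
- by under eq_fun do rewrite slopes_int; exact: cvg_cst.
Qed.

End derivative_integral.

(** * Integrating a derivative with an integrable bound *)

Lemma Bochner_integral_derivative (R : realType) (Y : normedModType R) (s t : R)
    (F dF : R -> Y) (g : R -> \bar R) :
  s <= t -> derivative_within s t F dF ->
  measurable_fun `[s, t] g -> (forall x, `[s, t]%classic x -> (`|dF x|%:E <= g x)%E) ->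
  (\int[lebesgue_measure]_(x in `[s, t]) g x < +oo)%E ->
  Bochner_integral `[s, t] dF (F t - F s).
Proof.
move=> st derF mg dFg fing.
have [E|neq] := eqVneq s t.
  (* The mesh vanishes when [s = t]; empty simple functions suffice, a point being null. *)
  rewrite -E subrr; exists (fun=> [::]); split.
  - by move=> n p; rewrite in_nil.
  - exists [set s]; split => //; first exact: lebesgue_measure_set1.
    by move=> x /= /not_implyP[]; rewrite in_itv/= -eq_le => /eqP.
  - under eq_fun do rewrite (@integral_Sset1 _ _ _ s) ?set_itv1//.
    exact: cvg_cst.
  - by rewrite /simple_int; under eq_fun do rewrite big_nil; exact: cvg_cst.
have ltst : s < t by rewrite lt_neqAle neq.
have g0 x : `[s, t]%classic x -> (0 <= g x)%E by move=> /dFg; exact: le_trans.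
have finD : (lebesgue_measure `[s, t]%classic < +oo)%E.
  by rewrite lebesgue_measure_itv/=; case: ifP; rewrite ?ltry// -EFinB ltry.
have mD : measurable `[s, t]%classic by exact: measurable_itv.
have [G [lscG G0 gG finG]] := lsc_majorant mD finD mg g0 fing.
apply: (Bochner_integral_of_lsc_majorant (G := G)) => //.
(* [gG] at [r = |dF x|] turns the weak bound by [g] into the strict bound by [G], even where [g] is
   infinite. *)
- by move=> x xst; apply: gG => //; apply: dFg; rewrite /= in_itv.
- apply: le_lt_trans finG; apply: ge0_subset_integral => //.
  + by apply: measurable_funTS; exact: lower_semicontinuous_measurable.
  + by apply: subset_itvl; rewrite bnd_simp.
Qed.

(** * Operator norms and semigroup estimates *)

Lemma le_opnorm (R : realType) (Y1 Y : normedModType R) (L : {linear Y1 -> Y}) (f : Y1) :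
  (`|L f|%:E <= `|f|%:E * opnorm L)%E.
Proof.
have [->|f0] := eqVneq f 0; first by rewrite linear0 !normr0 mul0e.
have nf0 : 0 < `|f| by rewrite normr_gt0.
rewrite -lee_pdivrMl//; apply: ereal_sup_ubound.
exists (`|f|^-1 *: f) => /=.
  by rewrite normrZ ger0_norm ?invr_ge0// mulVf// gt_eqF.
by rewrite linearZ/= normrZ ger0_norm ?invr_ge0// EFinM.
Qed.

Section semigroup.
Context {R : realType} {Y : completeNormedModType R}.
Variables (J : set R) (Gamma : R -> R -> Y -> Y).
Hypothesis convJ : forall a b u, J a -> J b -> a <= u -> u <= b -> J u.
Hypothesis Gsg : inhom_semigroup J Gamma.
Hypothesis Gcont : strongly_t_continuous J Gamma.

(** Each orbit over [[s, t]] is the continuous image of a compact set, hence bounded;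
    Banach-Steinhaus makes the bound uniform on the unit ball, and homogeneity extends it. *)
Lemma semigroup_uniform_bound s t : DeltaJ J s t ->
  exists2 M : R, 0 < M &
    forall u, s <= u <= t -> forall y, `|Gamma s u y| <= M * `|y|.
Proof.
move=> [Js [Jt st]]; have [Glin _] := Gsg.
have DJ u : s <= u <= t -> DeltaJ J s u.
  by move=> /andP[su ut]; split => //; split => //; exact: (convJ Js Jt).
pose S : set (Y -> Y) := [set Gamma s u | u in `[s, t]%classic].
have : uniform_bounded S.
  apply: Banach_Steinhauss => [_ [u + <-]|y].
    rewrite /= in_itv/= => /DJ/Glin[lin cont]; split => //.
    pose L : {linear Y -> Y} := HB.pack (Gamma s u) (GRing.isLinear.Build _ _ _ _ _ lin).
    by apply/(bounded_funP L)/linear_bounded_continuous.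
  have : compact [set Gamma s u y | u in `[s, t]%classic].
    have sub : `[s, t] `<=` Jfrom J s.
      by move=> u; rewrite /= in_itv/= => ust; have [_ []] := DJ u ust.
    apply: continuous_compact; last exact: segment_compact.
    exact: (continuous_subspaceW sub (@Gcont y s Js)).
  move=> /compact_bounded[M [_ HM]]; exists (M + 1) => _ [u ust <-].
  by apply: HM; [rewrite ltrDl|exists u].
move=> /(_ 1)[M HM]; exists (Num.max M 1); first by rewrite lt_max ltr01 orbT.
move=> u ust y; have [lin _] := Glin _ _ (DJ u ust).
pose L : {linear Y -> Y} := HB.pack (Gamma s u) (GRing.isLinear.Build _ _ _ _ _ lin).
rewrite -[Gamma s u]/(L : Y -> Y).
have [->|y0] := eqVneq y 0; first by rewrite linear0 normr0 mulr0.
have ny0 : 0 < `|y| by rewrite normr_gt0.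
rewrite -ler_pdivrMr// mulrC le_max; apply/orP; left.
have -> : `|y|^-1 * `|L y| = `|L (`|y|^-1 *: y)|.
  by rewrite linearZ/= normrZ ger0_norm ?invr_ge0.
apply: (HM (Gamma s u)); first by exists u => //=; rewrite in_itv.
by rewrite normrZ ger0_norm ?invr_ge0// mulVf// gt_eqF.
Qed.

Lemma strongly_t_continuous_dist f s x e : J s -> J x -> s <= x -> 0 < e ->
  exists2 d, 0 < d & forall y, J y -> s <= y -> `|x - y| < d ->
    `|Gamma s x f - Gamma s y f| < e.
Proof.
move=> Js Jx sx e0.
have /subspace_continuousP/(_ x (conj Jx sx))/cvgrPdist_lt/(_ e e0) := @Gcont f s Js.
move=> /nbhs_ballP[d /= d0 Hd]; exists d => // y Jy sy xy.
by apply: (Hd y).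
Qed.

Lemma semigroup_derivative (s t : R) (f : Y) (g : R -> Y) : DeltaJ J s t ->
  (forall x, J x -> generator_at J Gamma x f (g x)) ->
  derivative_within s t (fun u => Gamma s u f) (fun u => Gamma s u (g u)).
Proof.
move=> Dst gen x xst e e0; have [Js [Jt st]] := Dst.
have [Glin [_ Gmul]] := Gsg.
have [M M0 HM] := semigroup_uniform_bound Dst.
have JI u : s <= u <= t -> J u by move=> /andP[su ut]; exact: (convJ Js Jt).
have linB u : s <= u <= t -> forall y z, Gamma s u (y - z) = Gamma s u y - Gamma s u z.
  move=> ust y z; have /andP[su ut] := ust.
  have [lin _] := Glin s u (conj Js (conj (JI u ust) su)).
  pose L : {linear Y -> Y} := HB.pack (Gamma s u) (GRing.isLinear.Build _ _ _ _ _ lin).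
  exact: (linearB L).
have linZ u : s <= u <= t -> forall a y, Gamma s u (a *: y) = a *: Gamma s u y.
  move=> ust a y; have /andP[su ut] := ust.
  have [lin _] := Glin s u (conj Js (conj (JI u ust) su)).
  pose L : {linear Y -> Y} := HB.pack (Gamma s u) (GRing.isLinear.Build _ _ _ _ _ lin).
  exact: (linearZZ L).
(* The generator error is later multiplied by at most [M], which leaves [e / 2]; the other half is
   for strong continuity at [g x]. *)
have e1 : 0 < e / (2 * M) by rewrite divr_gt0// mulr_gt0.
have e2 : 0 < e / 2 by rewrite divr_gt0.
have Jx := JI x xst; have /andP[sx xt] := xst.
have [genr genl] := gen x Jx.
have [dr dr0 Hr] := genr _ e1; have [dl dl0 Hl] := genl _ e1.
have [dc dc0 Hc] := strongly_t_continuous_dist (g x) Js Jx sx e2.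
have quot h (z : Y) : 0 < h -> `|h^-1 *: z - g x| < e / (2 * M) ->
    `|z - h *: g x| <= h * (e / (2 * M)).
  move=> h0 hz; rewrite (_ : z - h *: g x = h *: (h^-1 *: z - g x)).
    by rewrite normrZ gtr0_norm// ler_pM2l// ltW.
  by rewrite scalerBr scalerA divff ?scale1r// gt_eqF.
have ME : M * (e / (2 * M)) = e / 2 by field; rewrite gt_eqF.
exists (Num.min dr (Num.min dl dc)); first by rewrite !lt_min dr0 dl0.
move=> y yst; rewrite !lt_min => /and3P[yr yl yc].
have Jy := JI y yst; have /andP[sy yt] := yst.
case: (ltgtP x y) => [xy|yx|<-]; last first.
- by rewrite !subrr scale0r subr0 !normr0 mulr0.
- have h0 : 0 < x - y by rewrite subr_gt0.
  have hE : `|y - x| = x - y by rewrite distrC gtr0_norm.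
  have xE : x - (x - y) = y by ring.
  have := Hl (x - y) h0; rewrite xE -hE => /(_ yl Jy); rewrite hE => /(quot _ _ h0) Hq.
  (* With [y < x], factor [Gamma s x] as [Gamma s y \o Gamma y x]. The generator error then sits
     under [Gamma s y], and replacing [Gamma s y (g x)] by [Gamma s x (g x)] costs the first
     term. *)
  have -> : Gamma s y f - Gamma s x f - (y - x) *: Gamma s x (g x) =
      (x - y) *: (Gamma s x (g x) - Gamma s y (g x)) -
      Gamma s y (Gamma y x f - f - (x - y) *: g x).
    rewrite !(linB y yst) (linZ y yst) -[Gamma s y (Gamma y x f)]/((Gamma s y \o Gamma y x) f).
    rewrite (Gmul s y x)//; last exact: ltW.
    rewrite -[in LHS](opprB x y) scaleNr opprK scalerBr opprD opprK.
    by rewrite addrACA addNr addr0 opprB addrC.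
  apply: (le_trans (ler_normB _ _)).
  apply: (@le_trans _ _ ((x - y) * (e / 2) + M * ((x - y) * (e / (2 * M))))).
    apply: lerD.
      rewrite normrZ gtr0_norm// ler_pM2l//; apply/ltW/Hc => //.
      by rewrite distrC.
    by apply: (le_trans (HM y yst _)); rewrite ler_pM2l.
  by rewrite [M * (_ * _)]mulrCA ME ?hE; lra.
- have h0 : 0 < y - x by rewrite subr_gt0.
  have hE : `|y - x| = y - x by rewrite gtr0_norm.
  have xE : x + (y - x) = y by ring.
  have := Hr (y - x) h0; rewrite xE -hE => /(_ yr Jy); rewrite hE => /(quot _ _ h0) Hq.
  have -> : Gamma s y f - Gamma s x f - (y - x) *: Gamma s x (g x) =
      Gamma s x (Gamma x y f - f - (y - x) *: g x).
    rewrite !(linB x xst) (linZ x xst) -[Gamma s x (Gamma x y f)]/((Gamma s x \o Gamma x y) f).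
    by rewrite (Gmul s x y)//; exact: ltW.
  apply: (le_trans (HM x xst _)).
  apply: (@le_trans _ _ (M * ((y - x) * (e / (2 * M))))); first by rewrite ler_pM2l.
  by have := mulr_gt0 h0 e0; rewrite [M * (_ * _)]mulrCA ME ?hE; lra.
Qed.

End semigroup.
Theorem theorem2p8 (R : realType) (Y Y1 : completeNormedModType R)
  (i : {linear Y1 -> Y}) (J : set R) (Gamma : R -> R -> Y -> Y)
  (A : R -> {linear Y1 -> Y}) :
  separable Y -> separable Y1 ->
  injective i -> continuous i ->
  (J = [set` `[0, +oo[%classic] \/ exists2 Tinf : R, 0 < Tinf & J = [set` `[0, Tinf]%classic]) ->
  inhom_semigroup J Gamma ->
  (* Y1 ⊆ D(A_Gamma), with A_Gamma(t) (i f) = A t f *)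
  (forall t, J t -> forall f : Y1, generator_at J Gamma t (i f) (A t f)) ->
  strongly_t_continuous J Gamma ->
  (* A_Gamma(t) ∈ B(Y1,Y) *)
  (forall t, J t -> continuous (A t)) ->
  (* u |-> ||A_Gamma(u)||_{B(Y1,Y)} ∈ L^1([s,t]) *)
  (forall s t, DeltaJ J s t ->
     measurable_fun `[s, t]%classic (fun u => opnorm (A u)) /\
     (\int[(@lebesgue_measure R)]_(u in `[s, t]%classic) opnorm (A u) < +oo)%E) ->
  forall (f : Y1) (s t : R), DeltaJ J s t ->
    Bochner_integral `[s, t]%classic (fun u => Gamma s u (A u f))
                     (Gamma s t (i f) - i f).
Proof.
move=> _ _ _ _ JE Gsg gen Gcont _ opA f s t Dst.
have convJ a b u : J a -> J b -> a <= u -> u <= b -> J u.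
  by case: JE => [->|[T _ ->]] /=; rewrite !inE/= !in_itv/= ?andbT => *; lra.
have [Js [Jt st]] := Dst.
have [M M0 HM] := semigroup_uniform_bound convJ Gsg Gcont Dst.
have [mA finA] := opA s t Dst.
have op0 u : (0 <= opnorm (A u))%E.
  by apply: ereal_sup_ubound; exists 0; rewrite /= ?linear0 ?normr0.
have c0 : 0 <= M * `|f| by rewrite mulr_ge0// ltW.
(* The subtracted [i f] becomes the value of the path at [s]. The rewriting also reaches the
   argument of [Gamma s t], which [Gss] restores. *)
have -> : i f = Gamma s s (i f) by have [_ [Gid _]] := Gsg; rewrite Gid.
have Gss : Gamma s t (Gamma s s (i f)) = Gamma s t (i f).
  by have [_ [Gid _]] := Gsg; rewrite (Gid s Js).
rewrite Gss.
(* The majorant combines the uniform bound [M] on [Gamma s u] with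
   [|A u f| <= |f| * opnorm (A u)]. *)
apply: (@Bochner_integral_derivative _ _ s t (fun u => Gamma s u (i f)) _
  (fun u => (M * `|f|)%:E * opnorm (A u))%E) => //.
- apply: (semigroup_derivative convJ Gsg Gcont Dst (g := fun u => A u f)).
  by move=> x Jx; exact: gen.
- exact: measurable_funeM.
- move=> x; rewrite /= in_itv/= => xst.
  rewrite EFinM -muleA; apply: (@le_trans _ _ (M%:E * `|A x f|%:E)%E).
    by rewrite -EFinM lee_fin HM.
  by rewrite lee_pmul2l//; exact: le_opnorm.
- by rewrite ge0_integralZl_EFin// lte_mul_pinfty.
Qed.
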